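(* Let $I\subset\mathbb R$ be an interval, $m>0$, and let $(\gamma,f):I\to\mathbb C\times\mathbb R$ be a $C^2$ curve with $f^2-|\gamma|^2=1$ and $f>0$. Let $T$ be the twizzler in $\mathbb H^3\subset\mathbb C\times\mathbb C\cong\mathbb R^4$ parameterized by $$T(u,v)=(e^{iv}\gamma(u),\,B_m(v)\,i f(u)),\qquad (u,v)\in I\times\mathbb R,\qquad B_m(v)=\begin{pmatrix}\cosh mv&\sinh mv\\ \sinh mv&\cosh mv\end{pmatrix},$$ and suppose $T$ is an immersion. Then $T$ has constant mean curvature in $\mathbb H^3$ if and only if there are real constants $H$ and $C$ such that, at every $u\in I$, $$C=\frac{2\pi}{\sqrt g}\,m f^2\,\langle\gamma',i\gamma\rangle+H\pi|\gamma|^2,$$ where $g=\langle T_u,T_u\rangle\langle T_v,T_v\rangle-\langle T_u,T_v\rangle^2$. Further, if $T$ is not a cylinder, then $H$ is the mean curvature of $T$.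
   Context: Lorentz model: let $Q=\mathrm{diag}(-1,-1,-1,1)$ and $\langle x,y\rangle=x^\top Qy$ on $\mathbb R^4$. Then $\mathbb H^3=\{x\in\mathbb R^4:\langle x,x\rangle=1,\ x_4>0\}$; its Riemannian metric is the restriction of $-\langle\cdot,\cdot\rangle$ to tangent spaces. $\mathbb R^4$ is identified with $\mathbb C\times\mathbb C$ via $(x_1,x_2,x_3,x_4)\leftrightarrow(x_1+ix_2,x_3+ix_4)$. The matrix $B_m(v)$ acts on the second factor $\mathbb C\cong\mathbb R^2$, so $if$ is the vector $(0,f)$ and $B_m(v)\,if=(f\sinh mv,f\cosh mv)$. For $\gamma',i\gamma\in\mathbb C$ (the first factor), $\langle\gamma',i\gamma\rangle$ is computed with $Q$, i.e. it is minus the Euclidean inner product of the plane vectors $\gamma'$ and $i\gamma$; $|\gamma|$ is the usual modulus. The quantity $g$ depends only on $u$. Mean curvature is the trace (not the average) of the second fundamental form of $T$ in $\mathbb H^3$, with sign given by $h=\mathrm{div}(\boldsymbol\nu)$, the trace over the tangent plane of $T$, with respect to the Riemannian metric, of $X\mapsto\mathrm D_X\boldsymbol\nu$, where $\mathrm D$ is the Levi-Civita connection of $\mathbb H^3$ and $\boldsymbol\nu$ is the unit normal of $T$ in $\mathbb H^3$ with $\det(T_u,T_v,\boldsymbol\nu,T)>0$. A cylinder in $\mathbb H^3$ is the twizzler of $(\gamma(u),f(u))=(ae^{iu},b)$ with $a,b\in\mathbb R$, $b^2-a^2=1$; ''$T$ is a cylinder'' means that $T$ lies on such a surface, i.e.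 $|\gamma|$ is constant on $I$. *)

(* Defs.v *)
From mathcomp Require Export all_boot all_order all_algebra.
From mathcomp Require Export complex.
From mathcomp Require Export all_classical all_reals all_analysis.
Export numFieldNormedType.Exports.
Export Order.TTheory GRing.Theory Num.Theory.

Set Implicit Arguments.
Unset Strict Implicit.
Unset Printing Implicit Defensive.

Local Open Scope classical_set_scope.
Local Open Scope complex_scope.
Local Open Scope ring_scope.

(* The filter [within I x^'] makes the derivative one-sided at an endpoint of
   I that belongs to I, and the usual derivative at an interior point. *)
Definition diff_quot {R : realType} (f : R -> R) (x y : R) : R :=
  (f y - f x) / (y - x).

Definition derivable_in {R : realType} (I : set R) (f : R -> R) (x : R) : Prop :=
  cvg (diff_quot f x @ within I x^').

Definition derive_in {R : realType} (I : set R) (f : R -> R) (x : R) : R :=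
  lim (diff_quot f x @ within I x^').

Definition C2_on {R : realType} (I : set R) (f : R -> R) : Prop :=
  [/\ forall x, I x -> derivable_in I f x,
      forall x, I x -> derivable_in I (derive_in I f) x
    & {within I, continuous (derive_in I (derive_in I f))}].

Definition cderive_in {R : realType} (I : set R) (g : R -> R[i]) (x : R) : R[i] :=
  derive_in I (fun u => complex.Re (g u)) x +i*
  derive_in I (fun u => complex.Im (g u)) x.

Definition expi {R : realType} (t : R) : R[i] := cos t +i* sin t.

Definition coshR {R : realType} (x : R) : R := (expR x + expR (- x)) / 2.
Definition sinhR {R : realType} (x : R) : R := (expR x - expR (- x)) / 2.

Definition lorentzQ {R : realType} : 'M[R]_4 :=
  diag_mx (\row_(i < 4) [:: -1; -1; -1; 1]`_i).

Definition lorentz {R : realType} (x y : 'cV[R]_4) : R :=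
  (x^T *m lorentzQ *m y) 0 0.

Definition hmetric {R : realType} (x y : 'cV[R]_4) : R := - lorentz x y.

(* The identification of C x C with R^4. *)
Definition vecCC {R : realType} (z w : R[i]) : 'cV[R]_4 :=
  \col_(i < 4)
    [:: complex.Re z; complex.Im z; complex.Re w; complex.Im w]`_i.

(* Parameterized surfaces T : I x R -> H^3, with T viewed in R^4. *)
Definition partial_u {R : realType} (I : set R) (T : R -> R -> 'cV[R]_4)
    (u v : R) : 'cV[R]_4 :=
  \col_(i < 4) derive_in I (fun s => T s v i 0) u.

Definition partial_v {R : realType} (T : R -> R -> 'cV[R]_4)
    (u v : R) : 'cV[R]_4 :=
  \col_(i < 4) derive1 (fun t => T u t i 0) v.

Definition immersion {R : realType} (I : set R) (T : R -> R -> 'cV[R]_4) : Prop :=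
  forall u v, I u -> \rank (row_mx (partial_u I T u v) (partial_v T u v)) = 2%N.

Definition gram_det {R : realType} (I : set R) (T : R -> R -> 'cV[R]_4)
    (u v : R) : R :=
  lorentz (partial_u I T u v) (partial_u I T u v) *
  lorentz (partial_v T u v) (partial_v T u v) -
  lorentz (partial_u I T u v) (partial_v T u v) ^+ 2.

(* Orthogonality to the position vector T u v says that n is tangent to H^3. *)
Definition is_unit_normal {R : realType} (I : set R) (T : R -> R -> 'cV[R]_4)
    (u v : R) (n : 'cV[R]_4) : Prop :=
  [/\ lorentz n (T u v) = 0,
      lorentz n (partial_u I T u v) = 0 /\ lorentz n (partial_v T u v) = 0,
      hmetric n n = 1
    & 0 < \det (\matrix_(i < 4, j < 4)
        (nth 0 [:: partial_u I T u v; partial_v T u v; n; T u v] j) i 0)].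

(* There is exactly one such n at a point where T is an immersion into H^3. *)
Definition unit_normal {R : realType} (I : set R) (T : R -> R -> 'cV[R]_4)
    (u v : R) : 'cV[R]_4 :=
  xget 0 [set n | is_unit_normal I T u v n].

(* Orthogonal projection of R^4 onto the tangent space of H^3 at p, where
   <p, p> = 1. The Levi-Civita connection of H^3 is the flat derivative of R^4
   followed by this projection. *)
Definition tan_proj {R : realType} (p w : 'cV[R]_4) : 'cV[R]_4 :=
  w - lorentz w p *: p.

Definition cov_u {R : realType} (I : set R) (T N : R -> R -> 'cV[R]_4)
    (u v : R) : 'cV[R]_4 :=
  tan_proj (T u v) (partial_u I N u v).

Definition cov_v {R : realType} (T N : R -> R -> 'cV[R]_4)
    (u v : R) : 'cV[R]_4 :=
  tan_proj (T u v) (partial_v N u v).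

(* Trace of X |-> D_X nu over the tangent plane of T, computed in the basis
   e = (T_u, T_v): with first fundamental form G i j = (e_i, e_j) and
   A i j = (D_(e_i) nu, e_j), the trace is that of G^-1 A. *)
Definition mean_curvature {R : realType} (I : set R) (T : R -> R -> 'cV[R]_4)
    (u v : R) : R :=
  let nu := unit_normal I T in
  let e := fun i : 'I_2 => nth 0 [:: partial_u I T u v; partial_v T u v] i in
  let De := fun i : 'I_2 => nth 0 [:: cov_u I T nu u v; cov_v T nu u v] i in
  \tr (invmx (\matrix_(i < 2, j < 2) hmetric (e i) (e j)) *m
       (\matrix_(i < 2, j < 2) hmetric (De i) (e j))).

Definition has_mean_curvature {R : realType} (I : set R)
    (T : R -> R -> 'cV[R]_4) (H : R) : Prop :=
  forall u v, I u -> mean_curvature I T u v = H.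

Definition Bmx {R : realType} (m v : R) : 'M[R]_2 :=
  \matrix_(i < 2, j < 2)
    if i == j then coshR (m * v) else sinhR (m * v).

(* Action of a real 2 x 2 matrix on C, identified with R^2. *)
Definition mxC {R : realType} (B : 'M[R]_2) (z : R[i]) : R[i] :=
  let w := B *m \col_(i < 2) [:: complex.Re z; complex.Im z]`_i in
  w 0 0 +i* w 1 0.

Definition twizzler {R : realType} (m : R) (gamma : R -> R[i]) (f : R -> R)
    (u v : R) : 'cV[R]_4 :=
  vecCC (expi v * gamma u) (mxC (Bmx m v) ('i%C * (f u)%:C)).

Definition is_cylinder {R : realType} (I : set R) (T : R -> R -> 'cV[R]_4)
    (m : R) : Prop :=
  exists a b : R, b ^+ 2 - a ^+ 2 = 1 /\
    forall u v, I u -> exists s t,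
      T u v = twizzler m (fun r => a%:C * expi r) (fun=> b) s t.

(* Main.v *)
Require Import Defs.
From mathcomp Require Import ring lra.

(* The curvature of T is computed with the unit normal, which is carried along
   by the screw motion and is given at v = 0 by a Lorentz cross product. Writing
   h(u) for the mean curvature, q = m f^2 <i gamma, gamma'>_E / sqrt g and
   rho = |gamma|^2, a direct computation gives 2 q' = h rho', so that
   2 q - H rho has derivative (h - H) rho'. Hence h = H makes 2 q - H rho
   constant. Conversely, if 2 q - H rho is constant then (h - H) rho' = 0. Where
   h <> H, rho is locally constant and h rho (1 + rho) = (1 + 2 rho) q, so h is
   locally constant there too; as h is continuous and the interval is connected,
   either h = H throughout, or h is a constant different from H and rho' = 0
   throughout, that is, T is a cylinder. *)

Set Implicit Arguments.
Unset Strict Implicit.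
Unset Printing Implicit Defensive.

Local Open Scope classical_set_scope.
Local Open Scope complex_scope.
Local Open Scope ring_scope.

(** * Derivatives relative to a set *)

Section OneSidedDerivative.
Variable R : realType.
Implicit Types (I J : set R) (f g : R -> R) (x y l c : R).

(** Relational form of [derive_in]: it carries the existence of the limit, whereas [lim] returns a
    default value when there is none. *)
Definition has_deriv I f x l : Prop := diff_quot f x @ within I x^' --> l.

(** In a nondegenerate interval every point is an accumulation point: slide from [x] towards another
    point of [I]. Properness makes derivatives unique. *)
Lemma within_dnbhs_proper I x :
  is_interval I -> (exists a b, [/\ I a, I b & a < b]) -> I x ->
  ProperFilter (within I x^').
Proof.
move=> itI [a [b [Ia Ib ab]]] Ix; apply: Build_ProperFilter.
have [y Iy yx] : exists2 y, I y & y != x.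
  by case: (eqVneq a x) => [<-|ax]; [exists b; rewrite // gt_eqF|exists a].
move=> /nbhs_ballP [e /= e0 He].
(* The bound 1/2 keeps [x + t * (y - x)] between [x] and [y]; the other bound keeps it within [e] of
   [x]. *)
pose t := Num.min (1 / 2) (e / (2 * `|y - x|)).
have yx0 : 0 < `|y - x| by rewrite normr_gt0 subr_eq0.
have t0 : 0 < t.
  by rewrite lt_min; apply/andP; split; [lra|apply: divr_gt0; lra].
have t1 : t <= 1 / 2 by rewrite ge_min lexx.
have te : t * `|y - x| < e.
  apply: (@le_lt_trans _ _ (e / (2 * `|y - x|) * `|y - x|)).
    by rewrite ler_pM2r // ge_min lexx orbT.
  have -> : e / (2 * `|y - x|) * `|y - x| = e / 2 by field; rewrite gt_eqF.
  lra.
apply: (He (x + t * (y - x))).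
- by rewrite /ball /= opprD addNKr normrN normrM (gtr0_norm t0).
- by rewrite -subr_eq0 addrC addKr mulf_neq0 ?subr_eq0 // gt_eqF.
- have [xy|xy] := leP x y; [apply: (itI x y)|apply: (itI y x)] => //; nra.
Qed.

Lemma near_within_dnbhs I x (P : R -> Prop) :
  (\forall y \near x, y != x -> I y -> P y) <->
  (\forall y \near within I x^', P y).
Proof. by []. Qed.

Lemma cvg_within_dnbhs_eq I f g x l :
  (forall y, y != x -> I y -> f y = g y) ->
  f @ within I x^' --> l -> g @ within I x^' --> l.
Proof.
move=> fg; apply: cvg_trans; apply: near_eq_cvg; apply/near_within_dnbhs.
by apply: (@nearW _ (nbhs x)) => y yx Iy; rewrite fg.
Qed.

Lemma has_deriv_unique I f x l l' : ProperFilter (within I x^') ->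
  has_deriv I f x l -> has_deriv I f x l' -> l = l'.
Proof. by move=> ?; apply: cvg_unique. Qed.

Lemma derive_in_eq I f x l : ProperFilter (within I x^') ->
  has_deriv I f x l -> derive_in I f x = l.
Proof. by move=> PF /cvg_lim; apply. Qed.

Lemma has_deriv_near_eq I f g x l : f x = g x ->
  (\forall y \near x, I y -> f y = g y) ->
  has_deriv I f x l -> has_deriv I g x l.
Proof.
move=> fgx fg; apply: cvg_trans; apply: near_eq_cvg; apply/near_within_dnbhs.
by apply: filterS fg => y fgy yx Iy; rewrite /diff_quot fgx fgy.
Qed.

Lemma has_deriv_eq I f g x l : I x -> (forall y, I y -> f y = g y) ->
  has_deriv I f x l -> has_deriv I g x l.
Proof.
move=> Ix fg df; apply: (has_deriv_near_eq _ _ df); first exact: fg.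
by apply: (@nearW _ (nbhs x)) => y; exact: fg.
Qed.

Lemma has_derivW I J f x l : J `<=` I -> has_deriv I f x l -> has_deriv J f x l.
Proof.
by move=> JI; apply: cvg_trans; apply: cvg_app; exact: within_subset.
Qed.

Lemma within_dnbhs_cvg I f x l :
  f @ within I (nbhs x) --> l -> f @ within I x^' --> l.
Proof.
apply: cvg_trans; apply: cvg_app => A; rewrite /within /= /dnbhs /within /=.
by apply: (@filterS _ (nbhs x)) => y h _.
Qed.

Lemma has_deriv_continuous I f x l :
  has_deriv I f x l -> f @ within I (nbhs x) --> f x.
Proof.
move=> df.
suff dn : f @ within I x^' --> f x.
  move=> A Afx; change (\forall y \near x, I y -> A (f y)).
  have /near_within_dnbhs : \forall y \near within I x^', A (f y) by exact: dn.
  apply: (@filterS _ (nbhs x)) => y h Iy.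
  by case: (eqVneq y x) => [->|yx]; [exact: nbhs_singleton|exact: h].
have lim : (fun y => f x + diff_quot f x y * (y - x)) @ within I x^' --> f x.
  rewrite -[X in _ --> X]addr0 -[X in _ --> _ + X](mulr0 l).
  apply: cvgD; first exact: cvg_cst.
  apply: cvgM; first exact: df.
  rewrite -(subrr x); apply: cvgB; last exact: cvg_cst.
  by apply: within_dnbhs_cvg; exact: cvg_within.
apply: cvg_within_dnbhs_eq lim => y yx _.
by rewrite /diff_quot divfK ?subr_eq0 // addrC subrK.
Qed.

Lemma has_deriv_cst I x (c : R) : has_deriv I (fun=> c) x 0.
Proof.
rewrite /has_deriv /diff_quot subrr.
by under eq_fun do rewrite mul0r; exact: cvg_cst.
Qed.

Lemma has_derivD I f g x a b : has_deriv I f x a -> has_deriv I g x b ->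
  has_deriv I (fun y => f y + g y) x (a + b).
Proof.
move=> df dg; apply: cvg_within_dnbhs_eq (cvgD df dg) => y _ _.
by rewrite /diff_quot /= fctE -mulrDl; congr (_ * _); ring.
Qed.

Lemma has_derivM I f g x a b : has_deriv I f x a -> has_deriv I g x b ->
  has_deriv I (fun y => f y * g y) x (a * g x + f x * b).
Proof.
move=> df dg.
have cf : f @ within I x^' --> f x.
  exact: within_dnbhs_cvg (has_deriv_continuous df).
have cg : (fun=> g x) @ within I x^' --> g x by exact: cvg_cst.
apply: cvg_within_dnbhs_eq (cvgD (cvgM df cg) (cvgM cf dg)) => y _ _.
by rewrite /diff_quot /= fctE /= mulrAC mulrA -mulrDl; congr (_ * _); ring.
Qed.

Lemma has_derivZ I f x a c : has_deriv I f x a ->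
  has_deriv I (fun y => c * f y) x (c * a).
Proof.
by move=> df; have := has_derivM (has_deriv_cst I x c) df; rewrite mul0r add0r.
Qed.

Lemma has_derivB I f g x a b : has_deriv I f x a -> has_deriv I g x b ->
  has_deriv I (fun y => f y - g y) x (a - b).
Proof.
move=> df dg; have := has_derivD df (has_derivZ (c := -1) dg); rewrite mulN1r.
by under eq_fun do rewrite mulN1r.
Qed.

(** Rationalizing the difference quotient leaves that of [f] over a product of square roots, so
    continuity of the square root is enough. *)
Lemma has_deriv_invsqrt I f x a :
  (forall y, I y -> 0 < f y) -> I x -> has_deriv I f x a ->
  has_deriv I (fun y => (Num.sqrt (f y))^-1) x
    (- a / (2 * f x * Num.sqrt (f x))).
Proof.
move=> f0 Ix df.
have FF : Filter (within I x^') by typeclasses eauto.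
have s0 y : I y -> Num.sqrt (f y) != 0.
  by move=> Iy; rewrite gt_eqF // sqrtr_gt0 f0.
have cs : (fun y => Num.sqrt (f y)) @ within I x^' --> Num.sqrt (f x).
  apply: (@cvg_comp _ _ _ f Num.sqrt _ (nbhs (f x)));
    last exact: sqrt_continuous.
  exact: within_dnbhs_cvg (has_deriv_continuous df).
have cc : (fun=> Num.sqrt (f x)) @ within I x^' --> Num.sqrt (f x).
  exact: cvg_cst.
have cden := cvgM (cvgM (cvgD cs cc) cs) cc.
have den0 : (Num.sqrt (f x) + Num.sqrt (f x)) * Num.sqrt (f x) * Num.sqrt (f x)
    != 0.
  by rewrite !mulf_neq0 ?s0 // -mulr2n mulrn_eq0 s0.
have <- : - a * ((Num.sqrt (f x) + Num.sqrt (f x)) * Num.sqrt (f x) *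
    Num.sqrt (f x))^-1 = - a / (2 * f x * Num.sqrt (f x)).
  have h : f x = Num.sqrt (f x) ^+ 2 by rewrite sqr_sqrtr ?ltW ?f0.
  move: h (s0 _ Ix); move: (Num.sqrt (f x)) => s -> sn0.
  by field; rewrite sn0 -mulr2n mulrn_eq0 sn0.
apply: cvg_within_dnbhs_eq (cvgM (cvgN df) (cvgV den0 (cden FF FF FF))).
move=> y yx Iy.
have h : (Num.sqrt (f y) - Num.sqrt (f x)) * (Num.sqrt (f y) + Num.sqrt (f x))
    = f y - f x.
  by rewrite -subr_sqr !sqr_sqrtr ?ltW ?f0.
rewrite /= /diff_quot !fctE -h; field.
rewrite !s0 //= subr_eq0 yx /= gt_eqF //.
by rewrite addr_gt0 // sqrtr_gt0 f0.
Qed.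

(** At interior points the relative derivative is the ordinary one, which is what the mean value
    theorem asks for. *)
Lemma has_deriv_is_derive I f x l (a b : R) :
  (forall y, a <= y <= b -> I y) -> a < x < b -> has_deriv I f x l ->
  is_derive x 1 f l.
Proof.
move=> abI /andP[ax xb] df.
have cf : (fun h => h^-1 *: (f (h *: 1 + x) - f x)) @ 0^' --> l.
  apply/cvgrPdist_lt => e e0.
  move/cvgrPdist_lt: df => /(_ e e0) /near_within_dnbhs /nbhs_ballP[d /= d0 H].
  have h0 : \forall h \near (0 : R)^', h != 0 :> R by exact: nbhs_dnbhs_neq.
  have hd : \forall h \near (0 : R)^',
      `|h| < Num.min d (Num.min (x - a) (b - x)).
    by apply: (@dnbhs0_lt R R^o); rewrite !lt_min d0 !subr_gt0 ax xb.
  apply: filterS2 h0 hd => h h0; rewrite !lt_min => /and3P[hd ha hb].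
  have := H (h + x); rewrite /ball /= opprD addrCA subrr addr0 normrN.
  have -> : h%:A + x = h + x by congr (_ + _); exact: mulr1.
  rewrite /diff_quot addrK [_ *: _]mulrC; apply => //.
    by rewrite -subr_eq0 addrK.
  by apply: abI; move: ha hb; rewrite !ltr_norml; lra.
apply: DeriveDef; last by apply: cvg_lim.
by apply/cvg_ex; exists l.
Qed.

Lemma has_deriv0_constant I f : is_interval I ->
  (forall x, I x -> has_deriv I f x 0) -> forall a b, I a -> I b -> f a = f b.
Proof.
move=> itI df.
suff H a b : I a -> I b -> a < b -> f a = f b.
  move=> a b Ia Ib; case: (ltgtP a b) => [ab|ba|->//]; first exact: H.
  by symmetry; exact: H.
move=> Ia Ib ab.
have abI y : a <= y <= b -> I y by exact: itI.
have [y||c _] := @MVT R f (fun=> 0) a b ab.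
- rewrite in_itv /= => yab; apply: (has_deriv_is_derive abI yab).
  by apply/df/abI; case/andP: yab => /ltW -> /ltW ->.
- apply: (@continuous_subspaceW _ _ _ I).
    by move=> y /=; rewrite in_itv; exact: abI.
  by apply/subspace_continuousP => y /df /has_deriv_continuous.
by rewrite mul0r => /eqP; rewrite subr_eq0 => /eqP.
Qed.

(* The set where F takes a given nonzero value is open and closed in I. *)
Lemma locally_constant_off_zero I (F : R -> R) : is_interval I ->
  (forall x, I x -> F @ within I (nbhs x) --> F x) ->
  (forall x, I x -> F x != 0 -> \forall y \near x, I y -> F y = F x) ->
  forall a b, I a -> I b -> F a != 0 -> F b = F a.
Proof.
move=> itI cF lF a b Ia Ib Fa.
pose S := [set y | I y /\ F y = F a].
suff SI : S = I by move: Ib; rewrite -SI => -[].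
have SaS : S a by [].
apply: ((connected_intervalP I).2 itI); first by exists a.
(* [S] is open in [I] as the trace of this interior: at points of [S] the value of [F] is nonzero,
   so [F] is constant nearby. *)
- exists (~` I `|` S)^°; first exact: open_interior.
  apply/seteqP; split => y [Iy].
    move=> Fy; split => //; have : F y != 0 by rewrite Fy.
    move=> /(lF y Iy); apply: filterS => z zI.
    by case: (pselect (I z)) => Iz; [right; split; rewrite // zI|left].
  by move=> /interior_subset [].
- exists (closure S); first exact: closed_closure.
  apply/seteqP; split => y [Iy].
    by move=> Fy; split=> //; exact: subset_closure.
  move=> clS; split => //; apply: contrapT => Fya.
  have : (F @ within I (nbhs y)) (~` [set F a]).
    apply: (cF y Iy); apply: open_nbhs_nbhs; split => //.
    exact/closed_openC/closed_eq.
  rewrite /= /within /= !near_simpl => /clS [z [[Iz Fz]]] /(_ Iz).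
  by rewrite /= Fz.
Qed.

End OneSidedDerivative.

(** * The profile curve *)

(* With gamma = x + i y, the notations below read p + i w = gamma^* gamma',
   k + i w' = gamma^* gamma'' and j + i l = gamma'^* gamma''. *)
Section ProfileAlgebra.
Variable R : realFieldType.
Variables m x y f x1 y1 f1 x2 y2 f2 : R.

Local Notation rho := (x ^+ 2 + y ^+ 2).
Local Notation p := (x * x1 + y * y1).
Local Notation w := (x * y1 - y * x1).
Local Notation A := (x1 ^+ 2 + y1 ^+ 2).
Local Notation k := (x * x2 + y * y2).
Local Notation w' := (x * y2 - y * x2).
Local Notation l := (x1 * y2 - y1 * x2).
Local Notation j := (x1 * x2 + y1 * y2).

(* The Gram determinant of the twizzler, as a sum of squares. *)
Definition gram (m x y x1 y1 f1 : R) : R :=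
  f1 ^+ 2 + m ^+ 2 * (x1 ^+ 2 + y1 ^+ 2 + (x * y1 - y * x1) ^+ 2).

(* The mean curvature times gram^(3/2). *)
Definition curv (m x y x1 y1 f1 x2 y2 : R) : R :=
  let rho := x ^+ 2 + y ^+ 2 in
  let w := x * y1 - y * x1 in
  let l := x1 * y2 - y1 * x2 in
  let A := x1 ^+ 2 + y1 ^+ 2 in
  m * (rho * l + 3 * w * f1 ^+ 2 - w * A +
       m ^+ 2 * ((1 + rho) * l + 2 * w * (A + w ^+ 2))).

(** The defining equation of the profile, half its derivative, and the derivative of that. *)
Hypothesis Hf : f ^+ 2 = 1 + rho.
Hypothesis H1 : f * f1 = p.
Hypothesis H2 : f * f2 + f1 ^+ 2 = A + k.

Lemma gram_ge0 : 0 <= gram m x y x1 y1 f1.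
Proof.
rewrite /gram; apply: addr_ge0; first exact: sqr_ge0.
by rewrite mulr_ge0 ?sqr_ge0 // !addr_ge0 ?sqr_ge0.
Qed.

Lemma gram_eq0 : gram m x y x1 y1 f1 = 0 -> m != 0 ->
  [/\ x1 = 0, y1 = 0 & f1 = 0].
Proof.
move=> /eqP + m0; have B : 0 <= x1 ^+ 2 + y1 ^+ 2 by rewrite addr_ge0 ?sqr_ge0.
have C : 0 <= x1 ^+ 2 + y1 ^+ 2 + w ^+ 2 by rewrite addr_ge0 ?sqr_ge0.
rewrite /gram paddr_eq0 ?sqr_ge0 //; last by rewrite mulr_ge0 ?sqr_ge0.
rewrite sqrf_eq0 mulf_eq0 sqrf_eq0 (negPf m0) /= paddr_eq0 ?sqr_ge0 //.
rewrite paddr_eq0 ?sqr_ge0 // !sqrf_eq0.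
by case/andP => /eqP -> /andP[/andP[/eqP -> /eqP ->] _].
Qed.

(** The relation left once [f] is eliminated; the identities below hold modulo multiples of it. *)
Lemma sqr_f1 : (1 + rho) * f1 ^+ 2 = p ^+ 2.
Proof. by rewrite -Hf -H1; ring. Qed.

(** The left side is EG - F^2 for the first fundamental form. The two sides agree by
    [rho * A = p ^+ 2 + w ^+ 2] and [sqr_f1]. *)
Lemma gramE :
  (A - f1 ^+ 2) * (rho + m ^+ 2 * f ^+ 2) - w ^+ 2 = gram m x y x1 y1 f1.
Proof.
rewrite /gram Hf; have := sqr_f1.
have : m ^+ 2 * ((1 + rho) * f1 ^+ 2) = m ^+ 2 * p ^+ 2 by rewrite sqr_f1.
lra.
Qed.

(** With q = m f^2 w / sqrt g, the left side is q' times g^(3/2), so this says q' = p h, where 2 p =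
    rho'. *)
Lemma first_integral_deriv :
  m * (2 * p * w + f ^+ 2 * w') * gram m x y x1 y1 f1
  - m * f ^+ 2 * w * (f1 * f2 + m ^+ 2 * (j + w * w')) =
  p * curv m x y x1 y1 f1 x2 y2.
Proof.
rewrite /curv /gram /=.
have e1 : f ^+ 2 * (f1 * f2) = p * (A + k - f1 ^+ 2).
  by rewrite -H1 -H2; ring.
have -> : m * f ^+ 2 * w * (f1 * f2 + m ^+ 2 * (j + w * w')) =
  m * w * (f ^+ 2 * (f1 * f2) + f ^+ 2 * m ^+ 2 * (j + w * w')) by ring.
rewrite e1 Hf.
have := sqr_f1 => e2.
have : (m * w') * ((1 + rho) * f1 ^+ 2) = m * w' * p ^+ 2 by rewrite sqr_f1.
lra.
Qed.

(** Here [k = - A], so [rho * A = w ^+ 2] and [rho * l = w * A]. The factor [rho * (1 + rho)] avoids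
    dividing by [rho]. After division by g^(3/2) this reads rho (1 + rho) h = (1 + 2 rho) q. *)
Lemma curv_critical : p = 0 -> f1 = 0 -> f2 = 0 ->
  rho * (1 + rho) * curv m x y x1 y1 f1 x2 y2 =
  m * (1 + rho) * w * (1 + 2 * rho) * gram m x y x1 y1 f1.
Proof.
move=> p0 f10 f20.
have k0 : k = - A by move: H2; rewrite f10 f20; lra.
have rA : rho * A = w ^+ 2.
  have -> : rho * A = p ^+ 2 + w ^+ 2 by ring.
  by rewrite p0; ring.
have rl : rho * l = w * A.
  have -> : rho * l = p * w' - w * k by ring.
  by rewrite p0 k0; ring.
rewrite /curv /gram f10 /=.
transitivity (m * (1 + rho) * (rho * (rho * l - w * A) +
    m ^+ 2 * ((1 + rho) * (rho * l) + 2 * w * (rho * A + rho * w ^+ 2)))).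
  by ring.
rewrite rl; transitivity (m * (1 + rho) * w * m ^+ 2 *
    ((1 + 2 * rho) * A + rho * A + 2 * rho * w ^+ 2)); first by ring.
by rewrite rA; ring.
Qed.

(* (nu1, nu2, f1, nu4) is the unit normal at v = 0 times sqrt gram. *)
Definition nu1 := m * f * (y1 * f - y * f1).
Definition nu2 := - (m * f * (x1 * f - x * f1)).
Definition nu4 := m * f * w.

Definition dnu1 := m * f1 * (y1 * f - y * f1) + m * f * (y2 * f - y * f2).
Definition dnu2 := - (m * f1 * (x1 * f - x * f1) + m * f * (x2 * f - x * f2)).
Definition dnu4 := m * f1 * w + m * f * w'.

(** At v = 0 the position is (x, y, 0, f), T_u is (x1, y1, 0, f1) and T_v is (-y, x, m f, 0); the
    next three identities are the Lorentz products with these. *)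
Lemma nu_position : - nu1 * x - nu2 * y + nu4 * f = 0.
Proof. rewrite /nu1 /nu2 /nu4; ring. Qed.

Lemma nu_Tu : - nu1 * x1 - nu2 * y1 + nu4 * f1 = 0.
Proof. rewrite /nu1 /nu2 /nu4; ring. Qed.

Lemma nu_Tv : nu1 * y - nu2 * x - f1 * (m * f) = 0.
Proof.
have -> : nu1 * y - nu2 * x - f1 * (m * f) =
    m * f * (f * p - rho * f1 - f1) by rewrite /nu1 /nu2; ring.
rewrite -H1; have -> : f * (f * f1) = f ^+ 2 * f1 by ring.
by rewrite Hf; ring.
Qed.

Lemma nu_norm : nu1 ^+ 2 + nu2 ^+ 2 + f1 ^+ 2 - nu4 ^+ 2 = gram m x y x1 y1 f1.
Proof.
have -> : nu1 ^+ 2 + nu2 ^+ 2 + f1 ^+ 2 - nu4 ^+ 2 = f1 ^+ 2 + m ^+ 2 * f ^+ 2 *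
   (f ^+ 2 * A - 2 * (f * f1) * p + rho * f1 ^+ 2 - w ^+ 2).
  by rewrite /nu1 /nu2 /nu4; ring.
rewrite /gram H1 Hf.
have e : (m ^+ 2 * rho) * ((1 + rho) * f1 ^+ 2) = m ^+ 2 * rho * p ^+ 2.
  by rewrite sqr_f1.
have e2 : m ^+ 2 * ((1 + rho) * f1 ^+ 2) = m ^+ 2 * p ^+ 2 by rewrite sqr_f1.
lra.
Qed.

(** The left side is the trace of adj(G) A, with A computed from the unnormalized normal. Both
    off-diagonal entries of A reduce to m (A + w^2 - f1^2) in the notation of this section, as the
    symmetry of the second fundamental form requires. *)
Lemma curvE :
  (rho + m ^+ 2 * f ^+ 2) * (dnu1 * x1 + dnu2 * y1 - dnu4 * f1)
  - w * (- dnu1 * y + dnu2 * x + f2 * (m * f))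
  - w * (- nu2 * x1 + nu1 * y1 - m * f1 * f1)
  + (A - f1 ^+ 2) * (nu2 * y + nu1 * x + m * nu4 * (m * f)) =
  curv m x y x1 y1 f1 x2 y2.
Proof.
have H2' : f * f2 = A + k - f1 ^+ 2 by rewrite -H2; ring.
have -> : dnu1 * x1 + dnu2 * y1 - dnu4 * f1 = m * (l + w * (A - f1 ^+ 2)).
  transitivity (m * (f ^+ 2 * l + w * (f * f2) - (f * f1) * w')).
    by rewrite /dnu1 /dnu2 /dnu4; ring.
  by rewrite Hf H1 H2'; ring.
have -> : - dnu1 * y + dnu2 * x + f2 * (m * f) = m * (A + w ^+ 2 - f1 ^+ 2).
  transitivity (m * (f * f2 - (f * f1) * p + rho * f1 ^+ 2 - f ^+ 2 * k +
      rho * (f * f2))).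
    by rewrite /dnu1 /dnu2; ring.
  by rewrite Hf H1 H2'; ring.
have -> : - nu2 * x1 + nu1 * y1 - m * f1 * f1 = m * (A + w ^+ 2 - f1 ^+ 2).
  transitivity (m * (f ^+ 2 * A - (f * f1) * p - f1 ^+ 2)).
    by rewrite /nu1 /nu2; ring.
  by rewrite Hf H1; ring.
have -> : nu2 * y + nu1 * x + m * nu4 * (m * f) = m * f ^+ 2 * w * (1 + m ^+ 2).
  by rewrite /nu1 /nu2 /nu4; ring.
rewrite /curv Hf /=.
(* One multiple of [sqr_f1] for each of the degrees 1 and 3 in [m]. *)
have e1 : m * w * ((1 + rho) * f1 ^+ 2) = m * w * p ^+ 2 by rewrite sqr_f1.
have e2 : m ^+ 3 * w * ((1 + rho) * f1 ^+ 2) = m ^+ 3 * w * p ^+ 2.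
  by rewrite sqr_f1.
lra.
Qed.

End ProfileAlgebra.

(** * Lorentz geometry of 4-vectors *)

Section Matrices.
Variable R : realType.
Implicit Types (n p q : 'cV[R]_4).

(** Entries are indexed by [nat] so that each minor has the same form again and the expansion can be
    iterated. *)
Lemma det_first_row (n : nat) (F : nat -> nat -> R) :
  \det (\matrix_(i < n.+1, j < n.+1) F i j) =
  \sum_(j < n.+1) F 0%N j *
    ((-1) ^+ j * \det (\matrix_(i < n, k < n) F i.+1 (bump j k))).
Proof.
rewrite (expand_det_row _ ord0); apply: eq_bigr => j _.
rewrite mxE /cofactor add0n; congr (_ * (_ * \det _)).
by apply/matrixP => i k; rewrite !mxE.
Qed.

Lemma det4E (F : nat -> nat -> R) :
  \det (\matrix_(i < 4, j < 4) F i j) =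
  let D3 a b c := F 1%N a * (F 2%N b * F 3%N c - F 2%N c * F 3%N b)
    - F 1%N b * (F 2%N a * F 3%N c - F 2%N c * F 3%N a)
    + F 1%N c * (F 2%N a * F 3%N b - F 2%N b * F 3%N a) in
  F 0%N 0%N * D3 1%N 2%N 3%N - F 0%N 1%N * D3 0%N 2%N 3%N
  + F 0%N 2%N * D3 0%N 1%N 3%N - F 0%N 3%N * D3 0%N 1%N 2%N.
Proof.
have d1 (G : nat -> nat -> R) : \det (\matrix_(i < 1, j < 1) G i j) = G 0%N 0%N.
  by rewrite det_mx11 mxE.
have d2 (G : nat -> nat -> R) : \det (\matrix_(i < 2, j < 2) G i j) =
    G 0%N 0%N * G 1%N 1%N - G 0%N 1%N * G 1%N 0%N.
  rewrite det_first_row.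
  under eq_bigr => j _ do rewrite (d1 (fun i k => G i.+1 (bump j k))).
  by rewrite !big_ord_recl big_ord0 /bump /=; ring.
have d3 (G : nat -> nat -> R) : \det (\matrix_(i < 3, j < 3) G i j) =
    G 0%N 0%N * (G 1%N 1%N * G 2%N 2%N - G 1%N 2%N * G 2%N 1%N)
    - G 0%N 1%N * (G 1%N 0%N * G 2%N 2%N - G 1%N 2%N * G 2%N 0%N)
    + G 0%N 2%N * (G 1%N 0%N * G 2%N 1%N - G 1%N 1%N * G 2%N 0%N).
  rewrite det_first_row.
  under eq_bigr => j _ do rewrite (d2 (fun i k => G i.+1 (bump j k))).
  by rewrite !big_ord_recl big_ord0 /bump /=; ring.
rewrite det_first_row.
under eq_bigr => j _ do rewrite (d3 (fun i k => F i.+1 (bump j k))).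
by rewrite !big_ord_recl big_ord0 /bump /=; ring.
Qed.

Lemma mxtrace_invmx2 (G A : 'M[R]_2) : G 0 0 * G 1 1 - G 0 1 * G 1 0 != 0 ->
  \tr (invmx G *m A) =
  (G 1 1 * A 0 0 - G 0 1 * A 1 0 - G 1 0 * A 0 1 + G 0 0 * A 1 1) /
  (G 0 0 * G 1 1 - G 0 1 * G 1 0).
Proof.
have natE (M : 'M[R]_2) : exists F : nat -> nat -> R, M = \matrix_(i, j) F i j.
  exists (fun i j => M (inord i) (inord j)).
  by apply/matrixP => i j; rewrite mxE !inord_val.
have [F ->] := natE G; have [F' ->] := natE A; rewrite !mxE /=.
set d := _ - _ => d0; set M := \matrix_(i, j) F i j.
pose N : 'M[R]_2 := d^-1 *: \matrix_(i, j)
  (* The adjugate over the determinant: [1 - i] swaps the two diagonal entries. *)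
  if i == j then F (1 - i)%N (1 - j)%N else - F i j.
have NM : N *m M = 1%:M.
  apply/matrixP => i j; rewrite !mxE !big_ord_recl big_ord0 !mxE /=.
  by case: i => [[|[|//]] ?]; case: j => [[|[|//]] ?] /=; rewrite /bump /=;
    rewrite ?(addn0, subn0, subnn); move: d0; rewrite /d => d0; field.
have -> : invmx M = N.
  have [_ Mu] := mulmx1_unit NM.
  by rewrite -[N]mulmx1 -(mulmxV Mu) mulmxA NM mul1mx.
rewrite /mxtrace !big_ord_recl big_ord0 !mxE !big_ord_recl !big_ord0 !mxE /=.
by rewrite /bump /=; field.
Qed.

Lemma lorentzDl n p q : lorentz (n + p) q = lorentz n q + lorentz p q.
Proof. by rewrite /lorentz linearD /= !mulmxDl mxE. Qed.

Lemma lorentzZl c n q : lorentz (c *: n) q = c * lorentz n q.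
Proof. by rewrite /lorentz linearZ /= -!scalemxAl mxE. Qed.

Definition vec4 (a b c d : R) : 'cV[R]_4 := \col_(i < 4) [:: a; b; c; d]`_i.

Lemma vec4_eta n : exists a b c d, n = vec4 a b c d.
Proof.
exists (n 0 0), (n 1 0), (n 2 0), (n 3 0); apply/colP => i; rewrite !mxE.
by case: i => [[|[|[|[|//]]]] ?] /=; congr (n _ 0); apply: val_inj.
Qed.

Lemma lorentz_vec4 a b c d a' b' c' d' :
  lorentz (vec4 a b c d) (vec4 a' b' c' d') =
  - (a * a') - b * b' - c * c' + d * d'.
Proof.
rewrite /lorentz /lorentzQ mul_mx_diag mxE !big_ord_recl big_ord0 !mxE /=; ring.
Qed.

Lemma lorentzC n p : lorentz n p = lorentz p n.
Proof.
have [a [b [c [d ->]]]] := vec4_eta n.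
have [a' [b' [c' [d' ->]]]] := vec4_eta p.
by rewrite !lorentz_vec4; ring.
Qed.

Definition frame (a b c d : 'cV[R]_4) : 'M[R]_4 :=
  \matrix_(i < 4, j < 4) (nth 0 [:: a; b; c; d] j) i 0.

(** The row z^T Q annihilates an invertible matrix, hence is zero, and Q only changes signs of
    coordinates. *)
Lemma lorentz_nondegenerate z a b c d : \det (frame a b c d) != 0 ->
  lorentz z a = 0 -> lorentz z b = 0 -> lorentz z c = 0 -> lorentz z d = 0 ->
  z = 0.
Proof.
move=> D za zb zc zd.
have /(congr1 (mulmx ^~ (invmx (frame a b c d)))) :
    z^T *m lorentzQ *m frame a b c d = 0.
  apply/rowP => j; rewrite mxE [RHS]mxE.
  under eq_bigr do rewrite [X in _ * X]mxE.
  transitivity (lorentz z (nth 0 [:: a; b; c; d] j)).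
    by rewrite /lorentz [RHS]mxE.
  by case: j => [[|[|[|[|//]]]] ?].
rewrite mulmxK ?unitmxE ?unitfE // mul0mx mul_mx_diag => z0.
apply/colP => i; have := congr1 (fun M : 'rV_4 => M 0 i) z0; rewrite !mxE.
case: i => [[|[|[|[|//]]]] ?] /= ; lra.
Qed.

(** Expanded along the third column, the one that the unit normal occupies. *)
Lemma det_frame_vec4 a1 a2 a3 a4 b1 b2 b3 b4 c1 c2 c3 c4 d1 d2 d3 d4 :
  \det (frame (vec4 a1 a2 a3 a4) (vec4 b1 b2 b3 b4)
    (vec4 c1 c2 c3 c4) (vec4 d1 d2 d3 d4)) =
  let D3 x1 x2 x3 y1 y2 y3 z1 z2 z3 :=
    x1 * (y2 * z3 - y3 * z2) - x2 * (y1 * z3 - y3 * z1)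
    + x3 * (y1 * z2 - y2 * z1) in
  c1 * D3 a2 a3 a4 b2 b3 b4 d2 d3 d4 - c2 * D3 a1 a3 a4 b1 b3 b4 d1 d3 d4
  + c3 * D3 a1 a2 a4 b1 b2 b4 d1 d2 d4 - c4 * D3 a1 a2 a3 b1 b2 b3 d1 d2 d3.
Proof.
pose F i j := nth 0 (nth [::] [:: [:: a1; a2; a3; a4]; [:: b1; b2; b3; b4];
  [:: c1; c2; c3; c4]; [:: d1; d2; d3; d4]] j) i.
transitivity (\det (\matrix_(i < 4, j < 4) F i j)).
  congr (\det _); apply/matrixP => i j; rewrite !mxE /F.
  by case: j => [[|[|[|[|//]]]] ?] /=; rewrite mxE.
rewrite det4E /F /=; ring.
Qed.

Lemma det_frame_scale3 a b c d k :
  \det (frame a b (k *: c) d) = k * \det (frame a b c d).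
Proof.
have [a1 [a2 [a3 [a4 ->]]]] := vec4_eta a.
have [b1 [b2 [b3 [b4 ->]]]] := vec4_eta b.
have [c1 [c2 [c3 [c4 ->]]]] := vec4_eta c.
have [d1 [d2 [d3 [d4 ->]]]] := vec4_eta d.
have -> : k *: vec4 c1 c2 c3 c4 = vec4 (k * c1) (k * c2) (k * c3) (k * c4).
  by apply/colP => i; rewrite !mxE; case: i => [[|[|[|[|//]]]] ?].
by rewrite !det_frame_vec4 /=; ring.
Qed.

End Matrices.

(** * Screw motions as isometries, and uniqueness of the unit normal *)

Section ScrewMotion.
Variable R : realType.
Implicit Types (m v a b c d : R) (I : set R).

Lemma sqr_coshR_sinhR (t : R) : coshR t ^+ 2 - sinhR t ^+ 2 = 1.
Proof.
rewrite /coshR /sinhR; have := expRxMexpNx_1 t; move: (expR t) (expR _) => a b.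
lra.
Qed.

(* The image of (a, b, c, d) under the rotation by v of the first plane and the
   boost by m v of the second. *)
Definition screw m v a b c d : 'cV[R]_4 :=
  vec4 (cos v * a - sin v * b) (sin v * a + cos v * b)
    (coshR (m * v) * c + sinhR (m * v) * d)
    (sinhR (m * v) * c + coshR (m * v) * d).

(** The rotation preserves the first two terms of the form and the boost the last two, so metric
    computations reduce to v = 0. *)
Lemma lorentz_screw m v a b c d a' b' c' d' :
  lorentz (screw m v a b c d) (screw m v a' b' c' d') =
  - (a * a') - b * b' - c * c' + d * d'.
Proof.
rewrite lorentz_vec4.
have := cos2Dsin2 v; have := sqr_coshR_sinhR (m * v).
move: (cos v) (sin v) (coshR _) (sinhR _) => C S Ch Sh h1 h2.
transitivity (- (C ^+ 2 + S ^+ 2) * (a * a' + b * b')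
  - (Ch ^+ 2 - Sh ^+ 2) * (c * c' - d * d')); first by ring.
by rewrite h1 h2; ring.
Qed.

(** A screw motion has determinant (cos^2 + sin^2)(cosh^2 - sinh^2) = 1. *)
Lemma det_frame_screw m v a1 a2 a3 a4 b1 b2 b3 b4 c1 c2 c3 c4 d1 d2 d3 d4 :
  \det (frame (screw m v a1 a2 a3 a4) (screw m v b1 b2 b3 b4)
    (screw m v c1 c2 c3 c4) (screw m v d1 d2 d3 d4)) =
  \det (frame (vec4 a1 a2 a3 a4) (vec4 b1 b2 b3 b4)
    (vec4 c1 c2 c3 c4) (vec4 d1 d2 d3 d4)).
Proof.
have := cos2Dsin2 v; have := sqr_coshR_sinhR (m * v).
rewrite /screw !det_frame_vec4 /=.
move: (cos v) (sin v) (coshR _) (sinhR _) => C S Ch Sh h1 h2.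
rewrite -[RHS]mul1r -[in RHS]h1 -[RHS]mul1r -[in RHS]h2; ring.
Qed.

Lemma twizzlerE m (gamma : R -> R[i]) (f : R -> R) : twizzler m gamma f =
  fun u v => screw m v (complex.Re (gamma u)) (complex.Im (gamma u)) 0 (f u).
Proof.
apply/funext => u; apply/funext => v; apply/colP => i.
rewrite /twizzler /screw /mxC !mxE !big_ord_recl !big_ord0 !mxE /=.
case: (gamma u) => x y /=.
by case: i => [[|[|[|[|//]]]] ?] /=; ring.
Qed.

Lemma is_derive_lincomb a b v (F G : R -> R) dF dG :
  is_derive v 1 F dF -> is_derive v 1 G dG ->
  is_derive v 1 (fun t => F t * a + G t * b) (dF * a + dG * b).
Proof.
move=> h1 h2; apply: is_derive_eq.
by rewrite !scaler0 !add0r ![_ *: _]mulrC.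
Qed.

Lemma is_derive_expZ c v :
  is_derive v 1 (fun t => expR (c * t)) (c * expR (c * v)).
Proof.
have dc : is_derive v 1 (fun t : R => c * t) c.
  by apply: is_derive_eq; rewrite scaler1 //= ?mulr1.
have := @is_derive1_comp _ expR (fun t => c * t) v _ _ (is_derive_expR _) dc.
by rewrite mulrC.
Qed.

Lemma is_derive_sinhR m v :
  is_derive v 1 (fun t => sinhR (m * t)) (m * coshR (m * v)).
Proof.
have := is_derive_lincomb 2^-1 (- 2^-1) (is_derive_expZ m v)
  (is_derive_expZ (- m) v).
rewrite /coshR /sinhR.
under eq_fun do rewrite mulrN -mulrBl mulNr.
have -> : m * expR (m * v) / 2 + - m * expR (- m * v) * - 2^-1 =
    m * ((expR (m * v) + expR (- (m * v))) / 2).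
  by rewrite !mulNr; field.
by [].
Qed.

Lemma is_derive_coshR m v :
  is_derive v 1 (fun t => coshR (m * t)) (m * sinhR (m * v)).
Proof.
have := is_derive_lincomb 2^-1 2^-1 (is_derive_expZ m v)
  (is_derive_expZ (- m) v).
rewrite /coshR /sinhR.
under eq_fun do rewrite -mulrDl mulNr.
have -> : m * expR (m * v) / 2 + - m * expR (- m * v) / 2 =
    m * ((expR (m * v) - expR (- (m * v))) / 2).
  by rewrite !mulNr; field.
by [].
Qed.

(** The coefficients of the screw motion depend on [v] alone, so it commutes with the derivative in
    [u]. Agreement over [I] suffices, which is all that is known of [unit_normal]. *)
Lemma partial_u_screw I (T : R -> R -> 'cV[R]_4) m (a b c d : R -> R)
    a' b' c' d' u v : ProperFilter (within I u^') -> I u ->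
  (forall s, I s -> T s v = screw m v (a s) (b s) (c s) (d s)) ->
  has_deriv I a u a' -> has_deriv I b u b' ->
  has_deriv I c u c' -> has_deriv I d u d' ->
  partial_u I T u v = screw m v a' b' c' d'.
Proof.
move=> PF Iu TE da db dc dd; apply/colP => i; rewrite !mxE.
apply: derive_in_eq.
pose F s := screw m v (a s) (b s) (c s) (d s) i 0.
apply: (@has_deriv_eq _ _ F) => //; first by move=> s Is; rewrite /F TE.
rewrite /F /screw; under eq_fun do rewrite mxE.
case: i {F} => [[|[|[|[|//]]]] ?] /=.
- by apply: has_derivB; exact: has_derivZ.
all: by apply: has_derivD; exact: has_derivZ.
Qed.

(** The generator of the motion sends (a, b, c, d) to (-b, a, m d, m c) and commutes with the
    motion. *)
Lemma partial_v_screw (T : R -> R -> 'cV[R]_4) m a b c d u v :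
  (forall t, T u t = screw m t a b c d) ->
  partial_v T u v = screw m v (- b) a (m * d) (m * c).
Proof.
move=> TE; apply/colP => i; rewrite !mxE derive1E.
under eq_fun do rewrite TE mxE.
have dch := is_derive_coshR m v; have dsh := is_derive_sinhR m v.
case: i => [[|[|[|[|//]]]] ?] /=.
- under eq_fun do rewrite -mulrN.
  have /@derive_val -> :=
    is_derive_lincomb a (- b) (is_derive_cos v) (is_derive_sin v).
  by ring.
- have /@derive_val -> :=
    is_derive_lincomb a b (is_derive_sin v) (is_derive_cos v).
  by ring.
- have /@derive_val -> := is_derive_lincomb c d dch dsh.
  by ring.
- have /@derive_val -> := is_derive_lincomb c d dsh dch.
  by ring.
Qed.

(** With k = <n', n>, the vector n' + k n is orthogonal to a whole frame, hence zero. The norm gives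
    k^2 = 1 and the orientation gives k < 0. *)
Lemma is_unit_normal_unique I (T : R -> R -> 'cV[R]_4) u v n n' :
  is_unit_normal I T u v n -> is_unit_normal I T u v n' -> n = n'.
Proof.
move=> [nT [nu nv] n1 nd] [nT' [nu' nv'] n1' nd'].
set k := lorentz n' n.
have nn : lorentz n n = -1 by rewrite -n1 /hmetric opprK.
have /eqP : n' + k *: n = 0.
  apply: (@lorentz_nondegenerate _ _ _ _ _ _ (lt0r_neq0 nd)).
  - by rewrite lorentzDl lorentzZl nu nu' mulr0 addr0.
  - by rewrite lorentzDl lorentzZl nv nv' mulr0 addr0.
  - by rewrite lorentzDl lorentzZl nn /k mulrN1 subrr.
  - by rewrite lorentzDl lorentzZl nT nT' mulr0 addr0.
rewrite addr_eq0 -scaleNr => /eqP n'E.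
have k2 : k ^+ 2 = 1.
  rewrite -n1' n'E /hmetric lorentzZl lorentzC lorentzZl nn; ring.
have k0 : k < 0.
  rewrite -oppr_gt0; move: nd'; rewrite n'E.
  by rewrite -/(frame _ _ _ _) det_frame_scale3 pmulr_lgt0.
have -> : n = (- k) *: n; last by rewrite -n'E.
have -> : - k = 1 by nra.
by rewrite scale1r.
Qed.

End ScrewMotion.

(** The projection removes a multiple of the position vector, invisible to tangent vectors: the flat
    derivative of the normal can be used. *)
Lemma hmetric_tan_proj (R : realType) (x w e : 'cV[R]_4) :
  lorentz x e = 0 -> hmetric (tan_proj x w) e = - lorentz w e.
Proof.
move=> xe; rewrite /hmetric /tan_proj -scaleNr lorentzDl lorentzZl xe.
by rewrite mulr0 addr0.
Qed.

(** * Continuity relative to a set *)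

Section WithinContinuity.
Variable R : realType.
Implicit Types (I : set R) (f g : R -> R) (x : R).

Definition wcont I f x : Prop := f @ within I (nbhs x) --> f x.

Lemma wcont_cst I c x : wcont I (fun=> c) x.
Proof. exact: cvg_cst. Qed.

Lemma wcontD I f g x : wcont I f x -> wcont I g x ->
  wcont I (fun y => f y + g y) x.
Proof. exact: cvgD. Qed.

Lemma wcontB I f g x : wcont I f x -> wcont I g x ->
  wcont I (fun y => f y - g y) x.
Proof. exact: cvgB. Qed.

Lemma wcontM I f g x : wcont I f x -> wcont I g x ->
  wcont I (fun y => f y * g y) x.
Proof. exact: cvgM. Qed.

Lemma wcontX I f n x : wcont I f x -> wcont I (fun y => f y ^+ n) x.
Proof.
move=> cf; elim: n => [|n IH]; first exact: wcont_cst.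
have -> : (fun y => f y ^+ n.+1) = (fun y => f y * f y ^+ n).
  by apply/funext => y; rewrite exprS.
exact: wcontM.
Qed.

End WithinContinuity.

(** * Twizzlers *)

Section Twizzler.
Variables (R : realType) (I : set R) (m : R).
Variables (x y f x1 y1 f1 x2 y2 f2 : R -> R).

Hypothesis itvI : is_interval I.
Hypothesis ntI : exists a b, [/\ I a, I b & a < b].
Hypothesis dx : forall u, I u -> has_deriv I x u (x1 u).
Hypothesis dy : forall u, I u -> has_deriv I y u (y1 u).
Hypothesis df : forall u, I u -> has_deriv I f u (f1 u).
Hypothesis dx1 : forall u, I u -> has_deriv I x1 u (x2 u).
Hypothesis dy1 : forall u, I u -> has_deriv I y1 u (y2 u).
Hypothesis df1 : forall u, I u -> has_deriv I f1 u (f2 u).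
Hypothesis cx2 : forall u, I u -> x2 @ within I (nbhs u) --> x2 u.
Hypothesis cy2 : forall u, I u -> y2 @ within I (nbhs u) --> y2 u.
Hypothesis sqrf : forall u, I u -> f u ^+ 2 = 1 + (x u ^+ 2 + y u ^+ 2).
Hypothesis f_gt0 : forall u, I u -> 0 < f u.

Let T u v := screw m v (x u) (y u) 0 (f u).
Hypothesis immT : immersion I T.
Hypothesis m_gt0 : 0 < m.

Let PF u (Iu : I u) : ProperFilter (within I u^') :=
  within_dnbhs_proper itvI ntI Iu.

Lemma profile_deriv1 u : I u -> f u * f1 u = x u * x1 u + y u * y1 u.
Proof.
move=> Iu; have PFu := PF Iu.
have d1 := has_derivM (df Iu) (df Iu).
have d2 := has_derivD (has_deriv_cst I u 1) (has_derivD
  (has_derivM (dx Iu) (dx Iu)) (has_derivM (dy Iu) (dy Iu))).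
have : f1 u * f u + f u * f1 u =
    0 + (x1 u * x u + x u * x1 u + (y1 u * y u + y u * y1 u)).
  apply: (has_deriv_unique PFu d1); apply: (has_deriv_eq Iu) d2 => s Is.
  by have := sqrf Is; rewrite !expr2 => ->.
lra.
Qed.

Lemma profile_deriv2 u : I u ->
  f u * f2 u + f1 u ^+ 2 =
  x1 u ^+ 2 + y1 u ^+ 2 + (x u * x2 u + y u * y2 u).
Proof.
move=> Iu; have PFu := PF Iu.
have d1 := has_derivM (df Iu) (df1 Iu).
have d2 := has_derivD (has_derivM (dx Iu) (dx1 Iu))
  (has_derivM (dy Iu) (dy1 Iu)).
have : f1 u * f1 u + f u * f2 u =
    x1 u * x1 u + x u * x2 u + (y1 u * y1 u + y u * y2 u).
  apply: (has_deriv_unique PFu d1); apply: (has_deriv_eq Iu) d2 => s Is.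
  by rewrite profile_deriv1.
lra.
Qed.

Lemma partial_u_T u v : I u ->
  partial_u I T u v = screw m v (x1 u) (y1 u) 0 (f1 u).
Proof.
move=> Iu; apply: (partial_u_screw (PF Iu) Iu) => //.
- exact: dx.
- exact: dy.
- exact: has_deriv_cst.
- exact: df.
Qed.

Lemma partial_v_T u v : partial_v T u v = screw m v (- y u) (x u) (m * f u) 0.
Proof.
by rewrite -[X in screw _ _ _ _ _ X](mulr0 m); exact: partial_v_screw.
Qed.

Definition gramT u := gram m (x u) (y u) (x1 u) (y1 u) (f1 u).

Lemma gram_detE u v : I u -> gram_det I T u v = gramT u.
Proof.
move=> Iu; rewrite /gram_det partial_u_T // partial_v_T !lorentz_screw.
rewrite /gramT -(gramE m (sqrf Iu) (profile_deriv1 Iu)); ring.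
Qed.

(** Where the sum of squares vanishes, so does T_u, and the rank drops below 2. *)
Lemma gramT_gt0 u : I u -> 0 < gramT u.
Proof.
move=> Iu; rewrite lt_def /gramT gram_ge0 andbT.
apply: contraPneq (immT 0 Iu) => /gram_eq0 -/(_ (lt0r_neq0 m_gt0)) [a1 a2 a3].
rewrite partial_u_T // a1 a2 a3.
have -> : screw m 0 0 0 0 0 = 0 :> 'cV[R]_4.
  apply/colP => i; rewrite !mxE !mulr0 subr0 !addr0.
  by case: i => [[|[|[|[|//]]]] ?].
rewrite rank_row_0mx => rk; have := rank_leq_col (partial_v T u 0).
by rewrite rk.
Qed.

(** * The unit normal of the twizzler *)

Definition inv_area u := (Num.sqrt (gramT u))^-1.

Definition nuT1 u := nu1 m (y u) (f u) (y1 u) (f1 u).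
Definition nuT2 u := nu2 m (x u) (f u) (x1 u) (f1 u).
Definition nuT4 u := nu4 m (x u) (y u) (f u) (x1 u) (y1 u).

Definition normal u v :=
  screw m v (inv_area u * nuT1 u) (inv_area u * nuT2 u)
    (inv_area u * f1 u) (inv_area u * nuT4 u).

Lemma inv_area_gt0 u : I u -> 0 < inv_area u.
Proof. by move=> Iu; rewrite /inv_area invr_gt0 sqrtr_gt0 gramT_gt0. Qed.

(** With r for [inv_area], the relation r^2 g = 1 replaces computations with square roots by
    polynomial ones. *)
Lemma sqr_inv_area u : I u -> inv_area u ^+ 2 * gramT u = 1.
Proof.
move=> Iu; rewrite /inv_area exprVn sqr_sqrtr ?mulVf ?gt_eqF ?gramT_gt0 //.
by rewrite ltW ?gramT_gt0.
Qed.

Lemma cube_inv_area u : I u -> inv_area u ^+ 3 * gramT u = inv_area u.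
Proof. by move=> Iu; rewrite exprS -mulrA sqr_inv_area // mulr1. Qed.

Lemma unit_normal_T u v : I u -> unit_normal I T u v = normal u v.
Proof.
move=> Iu; have Hf := sqrf Iu; have H1 := profile_deriv1 Iu.
apply: xget_subset1; last by move=> n n'; exact: is_unit_normal_unique.
rewrite /normal /nuT1 /nuT2 /nuT4; split.
- rewrite lorentz_screw.
  have := nu_position m (x u) (y u) (f u) (x1 u) (y1 u) (f1 u).
  move: (nu1 _ _ _ _ _) (nu2 _ _ _ _ _) (nu4 _ _ _ _ _ _) => n1 n2 n4 e.
  transitivity (inv_area u * (- n1 * x u - n2 * y u + n4 * f u)); first by ring.
  by rewrite e mulr0.
- rewrite partial_u_T // partial_v_T !lorentz_screw; split.
    have := nu_Tu m (x u) (y u) (f u) (x1 u) (y1 u) (f1 u).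
    move: (nu1 _ _ _ _ _) (nu2 _ _ _ _ _) (nu4 _ _ _ _ _ _) => n1 n2 n4 e.
    transitivity (inv_area u * (- n1 * x1 u - n2 * y1 u + n4 * f1 u)).
      by ring.
    by rewrite e mulr0.
  have := nu_Tv m Hf H1.
  move: (nu1 _ _ _ _ _) (nu2 _ _ _ _ _) (nu4 _ _ _ _ _ _) => n1 n2 n4 e.
  transitivity (inv_area u * (n1 * y u - n2 * x u - f1 u * (m * f u))).
    by ring.
  by rewrite e mulr0.
- rewrite /hmetric lorentz_screw -[RHS](sqr_inv_area Iu) /gramT.
  by rewrite -(nu_norm m Hf H1); ring.
- rewrite partial_u_T // partial_v_T -/(frame _ _ _ _) det_frame_screw.
  rewrite det_frame_vec4 /=.
  (* The cofactors of the third column give back the unnormalized normal up to the signs of the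
     metric, so the determinant is r times its squared norm g. *)
  rewrite [ltRHS](_ : _ = inv_area u * gramT u).
    by rewrite mulr_gt0 ?inv_area_gt0 ?gramT_gt0.
  have e3 : f u * (x u * x1 u + y u * y1 u) -
      (x u ^+ 2 + y u ^+ 2) * f1 u = f1 u.
    rewrite -H1; transitivity (f u ^+ 2 * f1 u - (x u ^+ 2 + y u ^+ 2) * f1 u).
      by ring.
    by rewrite Hf; ring.
  transitivity (inv_area u * (nuT1 u ^+ 2 + nuT2 u ^+ 2 +
    f1 u * (f u * (x u * x1 u + y u * y1 u) - (x u ^+ 2 + y u ^+ 2) * f1 u) -
    nuT4 u ^+ 2)); first by rewrite /nuT1 /nuT2 /nuT4 /nu1 /nu2 /nu4; ring.
  by rewrite e3 /gramT -(nu_norm m Hf H1) /nuT1 /nuT2 /nuT4; ring.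
Qed.

(** * Derivatives of the normal and the mean curvature *)

Definition dgramT u := 2 * (f1 u * f2 u + m ^+ 2 * (x1 u * x2 u + y1 u * y2 u +
  (x u * y1 u - y u * x1 u) * (x u * y2 u - y u * x2 u))).

Lemma has_deriv_w u : I u -> has_deriv I (fun s => x s * y1 s - y s * x1 s) u
  (x u * y2 u - y u * x2 u).
Proof.
move=> Iu; have := has_derivB (has_derivM (dx Iu) (dy1 Iu))
  (has_derivM (dy Iu) (dx1 Iu)).
by congr (has_deriv _ _ _ _); ring.
Qed.

Lemma has_deriv_gramT u : I u -> has_deriv I gramT u (dgramT u).
Proof.
move=> Iu; have d2 h h' : has_deriv I h u h' ->
    has_deriv I (fun s => h s ^+ 2) u (2 * (h u * h')).
  move=> dh; have := has_derivM dh dh; under eq_fun do rewrite -expr2.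
  by congr (has_deriv _ _ _ _); ring.
have := has_derivD (d2 _ _ (df1 Iu)) (has_derivZ (c := m ^+ 2)
  (has_derivD (has_derivD (d2 _ _ (dx1 Iu)) (d2 _ _ (dy1 Iu)))
    (d2 _ _ (has_deriv_w Iu)))).
by congr (has_deriv _ _ _ _); rewrite /dgramT; field.
Qed.

Definition dinv_area u := - (dgramT u / 2) * inv_area u ^+ 3.

Lemma has_deriv_inv_area u : I u -> has_deriv I inv_area u (dinv_area u).
Proof.
move=> Iu; have := has_deriv_invsqrt gramT_gt0 Iu (has_deriv_gramT Iu).
congr (has_deriv _ _ _ _); rewrite /dinv_area exprSr mulrA.
rewrite -[inv_area u ^+ 2](mulfK (lt0r_neq0 (gramT_gt0 Iu))) sqr_inv_area //.
have := gramT_gt0 Iu; rewrite /inv_area -sqrtr_gt0 => /lt0r_neq0 s0.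
by field; rewrite s0 gt_eqF ?gramT_gt0.
Qed.

Definition dnuT1 u := dnu1 m (y u) (f u) (y1 u) (f1 u) (y2 u) (f2 u).
Definition dnuT2 u := dnu2 m (x u) (f u) (x1 u) (f1 u) (x2 u) (f2 u).
Definition dnuT4 u :=
  dnu4 m (x u) (y u) (f u) (x1 u) (y1 u) (f1 u) (x2 u) (y2 u).

Lemma partial_u_normal u v : I u -> partial_u I (unit_normal I T) u v =
  screw m v (dinv_area u * nuT1 u + inv_area u * dnuT1 u)
    (dinv_area u * nuT2 u + inv_area u * dnuT2 u)
    (dinv_area u * f1 u + inv_area u * f2 u)
    (dinv_area u * nuT4 u + inv_area u * dnuT4 u).
Proof.
move=> Iu; apply: (partial_u_screw (PF Iu) Iu).
- by move=> s Is; rewrite unit_normal_T.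
- apply: has_derivM; first exact: has_deriv_inv_area.
  have := has_derivM (has_derivZ (c := m) (df Iu))
    (has_derivB (has_derivM (dy1 Iu) (df Iu)) (has_derivM (dy Iu) (df1 Iu))).
  by congr (has_deriv _ _ _ _); rewrite /dnuT1 /dnu1; ring.
- apply: has_derivM; first exact: has_deriv_inv_area.
  have := has_derivZ (c := -1) (has_derivM (has_derivZ (c := m) (df Iu))
    (has_derivB (has_derivM (dx1 Iu) (df Iu)) (has_derivM (dx Iu) (df1 Iu)))).
  under eq_fun do rewrite mulN1r.
  by congr (has_deriv _ _ _ _); rewrite /dnuT2 /dnu2; ring.
- exact: has_derivM (has_deriv_inv_area Iu) (df1 Iu).
- apply: has_derivM; first exact: has_deriv_inv_area.
  have := has_derivM (has_derivZ (c := m) (df Iu)) (has_deriv_w Iu).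
  by congr (has_deriv _ _ _ _); rewrite /dnuT4 /dnu4; ring.
Qed.

Lemma partial_v_normal u v : I u -> partial_v (unit_normal I T) u v =
  screw m v (- (inv_area u * nuT2 u)) (inv_area u * nuT1 u)
    (m * (inv_area u * nuT4 u)) (m * (inv_area u * f1 u)).
Proof.
by move=> Iu; apply: partial_v_screw => t; rewrite unit_normal_T.
Qed.

Definition curvT u := curv m (x u) (y u) (x1 u) (y1 u) (f1 u) (x2 u) (y2 u) *
  inv_area u ^+ 3.

(** The trace is [curvE] times r from the normalization and 1/g from the inverse metric, and r / g =
    r^3. *)
Lemma mean_curvatureE u v : I u -> mean_curvature I T u v = curvT u.
Proof.
move=> Iu; have Hf := sqrf Iu; have H1 := profile_deriv1 Iu.
have TT : lorentz (T u v) (partial_u I T u v) = 0 /\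
    lorentz (T u v) (partial_v T u v) = 0.
  rewrite partial_u_T // partial_v_T !lorentz_screw H1.
  by split; ring.
have [TTu TTv] := TT.
have a00 : hmetric (cov_u I T (unit_normal I T) u v) (partial_u I T u v) =
    inv_area u * (dnuT1 u * x1 u + dnuT2 u * y1 u - dnuT4 u * f1 u) -
    dinv_area u * (- nuT1 u * x1 u - nuT2 u * y1 u + nuT4 u * f1 u).
  rewrite hmetric_tan_proj // partial_u_normal // partial_u_T // lorentz_screw.
  by ring.
have a01 : hmetric (cov_u I T (unit_normal I T) u v) (partial_v T u v) =
    inv_area u * (- dnuT1 u * y u + dnuT2 u * x u + f2 u * (m * f u)) -
    dinv_area u * (nuT1 u * y u - nuT2 u * x u - f1 u * (m * f u)).
  rewrite hmetric_tan_proj // partial_u_normal // partial_v_T lorentz_screw.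
  by ring.
have a10 : hmetric (cov_v T (unit_normal I T) u v) (partial_u I T u v) =
    inv_area u * (- nuT2 u * x1 u + nuT1 u * y1 u - m * f1 u * f1 u).
  rewrite hmetric_tan_proj // partial_v_normal // partial_u_T // lorentz_screw.
  by ring.
have a11 : hmetric (cov_v T (unit_normal I T) u v) (partial_v T u v) =
    inv_area u * (nuT2 u * y u + nuT1 u * x u + m * nuT4 u * (m * f u)).
  rewrite hmetric_tan_proj // partial_v_normal // partial_v_T lorentz_screw.
  by ring.
(* The derivative of r multiplies the normal itself, which is orthogonal to T_u and T_v. *)
rewrite nu_Tu mulr0 subr0 in a00; rewrite nu_Tv // mulr0 subr0 in a01.
rewrite /mean_curvature; set G := \matrix_(i, j) hmetric _ _.
have G00 : G 0 0 = x1 u ^+ 2 + y1 u ^+ 2 - f1 u ^+ 2.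
  by rewrite mxE /= partial_u_T // /hmetric lorentz_screw; ring.
have G01 : G 0 1 = x u * y1 u - y u * x1 u.
  by rewrite mxE /= partial_u_T // partial_v_T /hmetric lorentz_screw; ring.
have G10 : G 1 0 = x u * y1 u - y u * x1 u.
  by rewrite mxE /= partial_u_T // partial_v_T /hmetric lorentz_screw; ring.
have G11 : G 1 1 = x u ^+ 2 + y u ^+ 2 + m ^+ 2 * f u ^+ 2.
  by rewrite mxE /= partial_v_T /hmetric lorentz_screw; ring.
have Gd : G 0 0 * G 1 1 - G 0 1 * G 1 0 = gramT u.
  by rewrite G00 G01 G10 G11 /gramT -(gramE m Hf H1); ring.
rewrite mxtrace_invmx2 Gd ?gt_eqF ?gramT_gt0 // G00 G01 G10 G11 !mxE /=.
(* Rewriting with a00 would try to unify it with the other three entries by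
   unfolding them, hence the detour through variables. *)
have key A00 A01 A10 A11 :
    A00 = inv_area u * (dnuT1 u * x1 u + dnuT2 u * y1 u - dnuT4 u * f1 u) ->
    A01 = inv_area u * (- dnuT1 u * y u + dnuT2 u * x u + f2 u * (m * f u)) ->
    A10 = inv_area u * (- nuT2 u * x1 u + nuT1 u * y1 u - m * f1 u * f1 u) ->
    A11 = inv_area u * (nuT2 u * y u + nuT1 u * x u + m * nuT4 u * (m * f u)) ->
    ((x u ^+ 2 + y u ^+ 2 + m ^+ 2 * f u ^+ 2) * A00 -
      (x u * y1 u - y u * x1 u) * A10 - (x u * y1 u - y u * x1 u) * A01 +
      (x1 u ^+ 2 + y1 u ^+ 2 - f1 u ^+ 2) * A11) / gramT u = curvT u;
  last exact: key a00 a01 a10 a11.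
move=> -> -> -> ->; rewrite /curvT -(curvE m Hf H1 (profile_deriv2 Iu)).
have -> : inv_area u ^+ 3 = inv_area u / gramT u.
  by rewrite -[in RHS](cube_inv_area Iu) mulfK // gt_eqF ?gramT_gt0.
rewrite [RHS]mulrA; congr (_ / _).
by rewrite /dnuT1 /dnuT2 /dnuT4 /nuT1 /nuT2 /nuT4; ring.
Qed.

(** * The first integral: [flux] is the q of the overview *)

Definition flux u := m * f u ^+ 2 * (x u * y1 u - y u * x1 u) * inv_area u.
Definition sqnorm u := x u ^+ 2 + y u ^+ 2.
(** Half the derivative of [sqnorm], and equal to [f u * f1 u] on [I]. *)
Definition radial u := x u * x1 u + y u * y1 u.

Lemma has_deriv_sqnorm u : I u -> has_deriv I sqnorm u (2 * radial u).
Proof.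
move=> Iu; have := has_derivD (has_derivM (dx Iu) (dx Iu))
  (has_derivM (dy Iu) (dy Iu)).
rewrite /sqnorm; under [in X in _ -> X]eq_fun do rewrite !expr2.
by congr (has_deriv _ _ _ _); rewrite /radial; ring.
Qed.

Lemma has_deriv_flux u : I u -> has_deriv I flux u (radial u * curvT u).
Proof.
move=> Iu; have := has_derivM (has_derivM
  (has_derivZ (c := m) (has_derivM (df Iu) (df Iu))) (has_deriv_w Iu))
  (has_deriv_inv_area Iu).
rewrite /flux; under [in X in _ -> X]eq_fun do rewrite !expr2.
congr (has_deriv _ _ _ _).
rewrite /dinv_area /curvT [RHS]mulrA /radial -(first_integral_deriv m (sqrf Iu)
  (profile_deriv1 Iu) (profile_deriv2 Iu)) -profile_deriv1 // -/(gramT u).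
(* Writing r as r^3 g gives both terms of the derivative the common factor r^3. *)
move: (cube_inv_area Iu); move: (inv_area u ^+ 3) => r3 <-.
by rewrite /dgramT; field.
Qed.

(** This is where continuity of the second derivatives enters; the other ingredients are
    differentiable. *)
Lemma curvT_continuous u : I u -> curvT @ within I (nbhs u) --> curvT u.
Proof.
move=> Iu; rewrite -/(wcont I curvT u).
have cx : wcont I x u := has_deriv_continuous (dx Iu).
have cy : wcont I y u := has_deriv_continuous (dy Iu).
have cx1 : wcont I x1 u := has_deriv_continuous (dx1 Iu).
have cy1 : wcont I y1 u := has_deriv_continuous (dy1 Iu).
have cf1 : wcont I f1 u := has_deriv_continuous (df1 Iu).
have cr : wcont I inv_area u := has_deriv_continuous (has_deriv_inv_area Iu).
have cx2u : wcont I x2 u := cx2 Iu.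
have cy2u : wcont I y2 u := cy2 Iu.
have cw : wcont I (fun s => x s * y1 s - y s * x1 s) u.
  exact: has_deriv_continuous (has_deriv_w Iu).
rewrite /curvT /curv; do ![assumption | apply: wcont_cst | apply: wcontB
  | apply: wcontD | apply: wcontX | apply: wcontM].
Qed.

(** * Consequences of a constant first integral *)

Section FirstIntegral.
Variables H c : R.
Hypothesis qE : forall u, I u -> 2 * flux u - H * sqnorm u = c.

Lemma first_integral_dichotomy u : I u -> radial u * (curvT u - H) = 0.
Proof.
move=> Iu; have PFu := PF Iu.
have d1 := has_derivB (has_derivZ (c := 2) (has_deriv_flux Iu))
  (has_derivZ (c := H) (has_deriv_sqnorm Iu)).
have d0 : has_deriv I (fun s => 2 * flux s - H * sqnorm s) u 0.
  by apply: (has_deriv_eq Iu) (has_deriv_cst I u c) => s Is; rewrite qE.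
by have := has_deriv_unique PFu d1 d0; lra.
Qed.

(* Where the curvature differs from H, the profile is locally at constant
   distance from the axis; there the curvature is a function of sqnorm and flux,
   and the first integral makes flux a function of sqnorm. *)
Lemma first_integral_locally_constant u : I u -> curvT u - H != 0 ->
  \forall y \near u, I y -> curvT y - H = curvT u - H.
Proof.
move=> Iu hu.
have : \forall s \near u, I s -> curvT s - H != 0.
  have : (fun s => curvT s - H) @ within I (nbhs u) --> curvT u - H.
    by apply: cvgB; [exact: curvT_continuous|exact: cvg_cst].
  move=> /cvgr_neq0 /(_ hu).
  by rewrite near_withinE.
move=> /nbhs_ballP [d /= d0 Hd].
apply/nbhs_ballP; exists d => //= t ut It.
(* A relative neighbourhood on which the curvature differs from [H], so [radial] vanishes. It is an
   interval, so zero derivatives give constants. *)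
pose J : set R := I `&` ball u d.
have Ju : J u by split => //; exact: ballxx.
have Jt : J t by [].
have itJ : is_interval J.
  move=> a b [Ia ua] [Ib ub] z azb; split; first exact: (itvI Ia Ib).
  by move: ua ub azb; rewrite /ball /= !ltr_distlC; lra.
have Jp s : J s -> radial s = 0.
  move=> [Is us]; have := first_integral_dichotomy Is.
  by move/eqP; rewrite mulf_eq0 (negPf (Hd s us Is)) orbF => /eqP.
have Jf1 s : J s -> f1 s = 0.
  move=> Js; have [Is _] := Js; have := profile_deriv1 Is.
  rewrite -/(radial s) Jp //.
  by move/eqP; rewrite mulf_eq0 gt_eqF ?f_gt0 // => /eqP.
have Jf2 s : J s -> f2 s = 0.
  move=> Js; have [Is us] := Js; have PFs := PF Is.
  apply: (has_deriv_unique PFs) (df1 Is) _.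
  apply: (has_deriv_near_eq _ _ (has_deriv_cst I s 0)); first by rewrite Jf1.
  have : nbhs s (ball u d).
    by apply: open_nbhs_nbhs; split=> //; exact: ball_open.
  by apply: (@filterS _ (nbhs s)) => z uz Iz; rewrite Jf1.
have Jrho : sqnorm t = sqnorm u.
  apply: (has_deriv0_constant itJ) => // s Js; have [Is _] := Js.
  have := has_deriv_sqnorm Is; rewrite Jp // mulr0; apply: has_derivW.
  by move=> z [].
have hE s : J s ->
    sqnorm s * (1 + sqnorm s) * curvT s = (1 + 2 * sqnorm s) * flux s.
  move=> Js; have [Is _] := Js.
  have := curv_critical m (profile_deriv2 Is) (Jp _ Js) (Jf1 _ Js) (Jf2 _ Js).
  rewrite -/(sqnorm s) -/(gramT s) => e.
  rewrite /curvT mulrA e /flux sqrf // -/(sqnorm s).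
  by rewrite -[in RHS](cube_inv_area Is); ring.
(* If gamma vanished at [u], then [profile_deriv2] with f1 = f2 = 0 would force gamma' = 0, and the
   Gram determinant would vanish. *)
have rho0 : sqnorm u != 0.
  have xy : 0 <= x u ^+ 2 /\ 0 <= y u ^+ 2 by rewrite !sqr_ge0.
  apply/eqP => r0; have x0 : x u = 0.
    by apply/eqP; rewrite -sqrf_eq0; apply/eqP; move: r0; rewrite /sqnorm; lra.
  have y0 : y u = 0.
    by apply/eqP; rewrite -sqrf_eq0; apply/eqP; move: r0; rewrite /sqnorm; lra.
  have := gramT_gt0 Iu; have := profile_deriv2 Iu.
  rewrite /gramT /gram Jf1 // Jf2 // x0 y0 => e.
  suff -> : x1 u ^+ 2 + y1 u ^+ 2 = 0 by lra.
  lra.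
have rho1 : 1 + sqnorm u != 0.
  rewrite gt_eqF // /sqnorm; have := sqr_ge0 (x u); have := sqr_ge0 (y u).
  lra.
have qtu : flux t = flux u by have := qE It; have := qE Iu; rewrite Jrho; lra.
congr (_ - _); apply: (mulfI (mulf_neq0 rho0 rho1)).
by rewrite [RHS]hE // -qtu -Jrho hE.
Qed.

(** Connectedness of [I] propagates the nonzero value of [curvT - H] at [a]. *)
Lemma first_integral_constant a b :
  I a -> I b -> curvT a != H -> curvT b = curvT a.
Proof.
move=> Ia Ib; rewrite -subr_eq0 => ha.
have := @locally_constant_off_zero _ I (fun s => curvT s - H) itvI _
  first_integral_locally_constant a b Ia Ib ha.
move=> /(_ _)/addIr; apply => s Is.
by apply: cvgB; [exact: curvT_continuous|exact: cvg_cst].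
Qed.

End FirstIntegral.

Lemma first_integral_of_constant H : (forall u, I u -> curvT u = H) ->
  forall a b, I a -> I b ->
    2 * flux a - H * sqnorm a = 2 * flux b - H * sqnorm b.
Proof.
move=> hH; apply: (has_deriv0_constant itvI) => u Iu.
have := has_derivB (has_derivZ (c := 2) (has_deriv_flux Iu))
  (has_derivZ (c := H) (has_deriv_sqnorm Iu)).
by congr (has_deriv _ _ _ _); rewrite hH //; ring.
Qed.

Lemma sqnorm_constant : (forall u, I u -> radial u = 0) ->
  forall a b, I a -> I b -> sqnorm a = sqnorm b.
Proof.
move=> p0; apply: (has_deriv0_constant itvI) => u Iu.
by have := has_deriv_sqnorm Iu; rewrite p0 // mulr0.
Qed.

(** If the curvature misses [H] at one point, it is a constant other than [H], so the dichotomy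
    makes [radial] vanish on all of [I]. *)
Lemma constant_curvature_of_first_integral H c :
  (forall u, I u -> 2 * flux u - H * sqnorm u = c) ->
  ~ (forall a b, I a -> I b -> sqnorm a = sqnorm b) ->
  forall u, I u -> curvT u = H.
Proof.
move=> qE nrho u Iu; apply: contra_notP nrho => /eqP hu.
apply: sqnorm_constant => b Ib.
have := first_integral_dichotomy qE Ib.
rewrite (first_integral_constant qE Iu Ib hu) => /eqP.
by rewrite mulf_eq0 subr_eq0 (negPf hu) orbF => /eqP.
Qed.

Lemma constant_curvature_iff_first_integral :
  (exists H, forall u, I u -> curvT u = H) <->
  (exists H c, forall u, I u -> 2 * flux u - H * sqnorm u = c).
Proof.
split=> [[H hH]|[H [c qE]]].
  have [a [_ [Ia _ _]]] := ntI; exists H, (2 * flux a - H * sqnorm a) => u Iu.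
  exact: first_integral_of_constant.
have [hH|/existsNP[a /not_implyP[Ia /eqP ha]]] :=
    pselect (forall u, I u -> curvT u = H); first by exists H.
(* The exceptional case: the constant curvature is [curvT a], not the given [H]. *)
by exists (curvT a) => u Iu; exact: (first_integral_constant qE).
Qed.

End Twizzler.

(** * Polar coordinates and the final assembly *)

Lemma polar_form (R : realType) (x y : R) : exists t : R,
  x = Num.sqrt (x ^+ 2 + y ^+ 2) * cos t /\
  y = Num.sqrt (x ^+ 2 + y ^+ 2) * sin t.
Proof.
set a := Num.sqrt _.
have xy0 : 0 <= x ^+ 2 + y ^+ 2 by rewrite addr_ge0 ?sqr_ge0.
have a2 : a ^+ 2 = x ^+ 2 + y ^+ 2 by rewrite /a sqr_sqrtr.
have [a0|a0] := eqVneq a 0.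
  exists 0; rewrite a0 !mul0r; move: a2; rewrite a0 expr0n /= => /esym/eqP.
  by rewrite paddr_eq0 ?sqr_ge0 // !sqrf_eq0 => /andP[/eqP -> /eqP ->].
have ap : 0 < a by rewrite lt_def a0 sqrtr_ge0.
have c1 : -1 <= x / a <= 1.
  rewrite -ler_norml normrM normfV (gtr0_norm ap) ler_pdivrMr // mul1r.
  by rewrite -sqrtr_sqr ler_wsqrtr // lerDl sqr_ge0.
clearbody a; pose t := acos (x / a).
have ct : a * cos t = x by rewrite /t acosK ?in_itv //= mulrC divfK.
have st : a * sin t = `|y|.
  have {1}-> : a = Num.sqrt (a ^+ 2) by rewrite sqrtr_sqr gtr0_norm.
  rewrite /t sin_acos // -sqrtrM ?sqr_ge0 //.
  have -> : a ^+ 2 * (1 - (x / a) ^+ 2) = a ^+ 2 - x ^+ 2 by field.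
  by rewrite a2 addrAC subrr add0r sqrtr_sqr.
(* [acos] yields an angle with nonnegative sine; the sign of [y] decides between it and its
   opposite. *)
have [y0|y0] := leP 0 y.
  by exists t; rewrite ct st ger0_norm.
by exists (- t); rewrite cosN sinN mulrN ct st ltr0_norm // opprK.
Qed.

Theorem theorem3p9 (R : realType) (I : set R) (m : R)
    (gamma : R -> R[i]) (f : R -> R) :
  is_interval I -> (exists a b, [/\ I a, I b & a < b]) ->
  0 < m ->
  C2_on I (fun u => complex.Re (gamma u)) ->
  C2_on I (fun u => complex.Im (gamma u)) ->
  C2_on I f ->
  (forall u, I u -> f u ^+ 2 - Normc.normc (gamma u) ^+ 2 = 1) ->
  (forall u, I u -> 0 < f u) ->
  let T := twizzler m gamma f in
  immersion I T ->
  let first_integral := fun H C : R =>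
    forall u v, I u ->
      C = 2 * pi / Num.sqrt (gram_det I T u v) * m * f u ^+ 2 *
            lorentz (vecCC (cderive_in I gamma u) 0) (vecCC ('i%C * gamma u) 0) +
          H * pi * Normc.normc (gamma u) ^+ 2 in
  ((exists H0 : R, has_mean_curvature I T H0) <->
   (exists H C : R, first_integral H C)) /\
  (~ is_cylinder I T m ->
   forall H C : R, first_integral H C -> has_mean_curvature I T H).
Proof.
move=> itvI ntI m0 [dx dx1 cx2] [dy dy1 cy2] [df df1 _] norm1 f0.
pose x u := complex.Re (gamma u); pose y u := complex.Im (gamma u).
pose T u v := screw m v (x u) (y u) 0 (f u).
have -> : twizzler m gamma f = T by exact: twizzlerE.
move=> T' immT first_integral; subst T'.
pose x1 := derive_in I x; pose y1 := derive_in I y; pose f1 := derive_in I f.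
pose x2 := derive_in I x1; pose y2 := derive_in I y1; pose f2 := derive_in I f1.
have normE u : Normc.normc (gamma u) ^+ 2 = sqnorm x y u.
  rewrite /sqnorm /x /y; case: (gamma u) => a b /=.
  by rewrite sqr_sqrtr // addr_ge0 ?sqr_ge0.
have sqrf u : I u -> f u ^+ 2 = 1 + (x u ^+ 2 + y u ^+ 2).
  by move=> /norm1; rewrite normE /sqnorm; lra.
have cx2' u : I u -> x2 @ within I (nbhs u) --> x2 u.
  by move/subspace_continuousP : cx2; exact.
have cy2' u : I u -> y2 @ within I (nbhs u) --> y2 u.
  by move/subspace_continuousP : cy2; exact.
pose hT := curvT m x y x1 y1 f1 x2 y2.
pose qT := flux m x y f x1 y1 f1.
have hE u v : I u -> mean_curvature I T u v = hT u.
  by move=> Iu; apply: (@mean_curvatureE _ _ _ x y f x1 y1 f1 x2 y2 f2 itvI ntI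
    dx dy df dx1 dy1 df1 sqrf immT m0 u v).
have gE u v : I u -> gram_det I T u v = gramT m x y x1 y1 f1 u.
  by move=> Iu; apply: (@gram_detE _ _ m x y f x1 y1 f1 itvI ntI dx dy df sqrf).
have hmcE H : has_mean_curvature I T H <-> (forall u, I u -> hT u = H).
  split=> [hH u Iu|hH u v Iu]; first by rewrite -(hE u 0 Iu) hH.
  by rewrite hE // hH.
have pi0 : pi != 0 :> R by rewrite gt_eqF ?pi_gt0.
(* Since <gamma', i gamma> is minus the Euclidean product, the stated expression is -pi (2 q - H
   rho), which turns the constant [C] into [- C / pi]. *)
have fiE H C : first_integral H C <->
    (forall u, I u -> 2 * qT u - H * sqnorm x y u = - C / pi).
  have E u v : I u -> 2 * pi / Num.sqrt (gram_det I T u v) * m * f u ^+ 2 *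
      lorentz (vecCC (cderive_in I gamma u) 0) (vecCC ('i%C * gamma u) 0) +
      H * pi * Normc.normc (gamma u) ^+ 2 =
      - pi * (2 * qT u - H * sqnorm x y u).
    move=> Iu; rewrite gE // normE.
    have -> : lorentz (vecCC (cderive_in I gamma u) 0)
        (vecCC ('i%C * gamma u) 0) = - (x u * y1 u - y u * x1 u).
      rewrite lorentz_vec4 /= -/x -/y -/x1 -/y1 /x /y.
      by case: (gamma u) => a b /=; ring.
    by rewrite /qT /flux /inv_area; ring.
  split=> [fi u Iu|fi u v Iu]; last first.
    by rewrite E // fi // !mulNr mulrN opprK mulrCA mulfV ?mulr1.
  by rewrite (fi u 0 Iu) E // !mulNr opprK mulrAC mulfV ?mul1r.
have := @constant_curvature_iff_first_integral _ I m x y f x1 y1 f1 x2 y2 f2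
  itvI ntI dx dy df dx1 dy1 df1 cx2' cy2' sqrf f0 immT m0.
have := @constant_curvature_of_first_integral _ I m x y f x1 y1 f1 x2 y2 f2
  itvI ntI dx dy df dx1 dy1 df1 cx2' cy2' sqrf f0 immT m0.
rewrite -/hT -/qT => noncyl iff_fi; split.
  split=> [[H /hmcE hH]|[H [C /fiE fi]]].
    have [H' [c fi]] := iff_fi.1 (ex_intro _ H hH).
    exists H', (- (pi * c)); apply/fiE => u Iu; rewrite fi //.
    by rewrite opprK mulrAC mulfV ?mul1r.
  have [H' hH'] := iff_fi.2 (ex_intro _ H (ex_intro _ _ fi)).
  by exists H'; apply/hmcE.
(* It remains to see that a constant |gamma| puts T on a cylinder. *)
move=> ncyl H C /fiE fi; apply/hmcE; apply: (noncyl _ _ fi) => rhoC.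
apply: ncyl; have [a0 [_ [Ia0 _ _]]] := ntI.
(* The radius and height are read off at the base point [a0]. *)
exists (Num.sqrt (sqnorm x y a0)), (f a0); split.
  by rewrite sqrf // sqr_sqrtr ?addr_ge0 ?sqr_ge0 // /sqnorm; ring.
move=> u v Iu; have [t [xt yt]] := polar_form (x u) (y u).
(* The cylinder parameter is the argument of gamma(u), with [v] unchanged. *)
exists t, v; rewrite twizzlerE /T /=.
(* The square of [f] is determined by |gamma|, and positivity selects the root. *)
have fE : f u = f a0.
  apply/eqP; rewrite -(eqrXn2 (_ : 0 < 2)%N) ?ltW ?f0 // !sqrf //.
  by rewrite -!/(sqnorm x y _) (rhoC _ _ Iu Ia0).
rewrite fE -(rhoC _ _ Iu Ia0) !mul0r subr0 addr0.
by congr (screw _ _ _ _ _ _).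
Qed.
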